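(* Let $J\subseteq\mathbb{Z}[x_0,\dots,x_n]$ be a strongly stable ideal and let $\mathfrak{I}_J\subseteq\mathbb{Z}[\mathbf{C}]$ be the ideal generated by the $\mathbf{x}$-coefficients of the polynomials in $\mathcal{N}(J,\mathcal{I})$. Then $\mathfrak{I}_J$ is the ideal generated by all the polynomials $$P_{\alpha\alpha'}^{\delta}:=E_{\alpha\alpha'\delta}+\sum_{x^\gamma\in J_s}E_{\alpha\alpha'\gamma}D_{\gamma\delta},\qquad s=\deg S^{\mathrm{EK}}(f_\alpha,f_{\alpha'}),\quad x^\delta\in\mathcal{N}(J)_s,$$ for $\alpha,\alpha'$ ranging over the pairs such that $x^\alpha,x^{\alpha'}\in\mathcal{B}_J$ are involved in a syzygy of Eliahou-Kervaire type.
   Context: Variables are ordered $x_0<\dots<x_n$; $\min x^\alpha$, $\max x^\alpha$ are the smallest and greatest variable dividing $x^\alpha$ (the condition $\min x^\alpha\ge\max x^\delta$ is considered satisfied if one of the two monomials is $1$). $D_s$ denotes the degree-$s$ part of a set $D$ with respect to $\mathbf{x}=(x_0,\dots,x_n)$. A monomial ideal $J$ is strongly stable if for every monomial $x^\alpha\in J$, every $x_j\mid x^\alpha$ and every $x_i>x_j$, one has $\frac{x_i}{x_j}x^\alpha\in J$. $\mathcal{B}_J$ is the minimal monomial generating set of $J$ and $\mathcal{N}(J)$ the set of monomials not in $J$. Each monomial of $J$ has a unique decomposition $x^\gamma x^\delta$ with $x^\gamma\in\mathcal{B}_J$ and $\min x^\gamma\ge\max x^\delta$, written $x^\gamma\ast_J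 x^\delta$. $\mathbf{C}$ is the set of variables $C_{\alpha\beta}$, with $x^\alpha\in\mathcal{B}_J$, $x^\beta\in\mathcal{N}(J)_{|\alpha|}$. Let $\mathcal{F}_J:=\{f_\alpha=x^\alpha-\sum_{x^\beta\in\mathcal{N}(J)_{|\alpha|}}C_{\alpha\beta}x^\beta\mid x^\alpha\in\mathcal{B}_J\}\subseteq\mathbb{Z}[\mathbf{C}][\mathbf{x}]$ and let $\mathcal{I}$ be the ideal of $\mathbb{Z}[\mathbf{C}][\mathbf{x}]$ it generates. $\mathcal{N}(J,\mathcal{I}):=\mathcal{I}\cap{}_{\mathbb{Z}[\mathbf{C}]}\langle\mathcal{N}(J)\rangle$, where ${}_{\mathbb{Z}[\mathbf{C}]}\langle\cdot\rangle$ denotes the $\mathbb{Z}[\mathbf{C}]$-submodule generated. The $\mathbf{x}$-coefficients of a polynomial of $\mathbb{Z}[\mathbf{C}][\mathbf{x}]$ are the coefficients in $\mathbb{Z}[\mathbf{C}]$ of the monomials in $\mathbf{x}$. Coefficients $D_{\gamma\delta}$: for each $s$ let $\mathcal{F}_J^{(s)}:=\{x^\delta f_\alpha\mid\deg(x^\delta f_\alpha)=s,\ f_\alpha\in\mathcal{F}_J,\ \min x^\alpha\ge\max x^\delta\}$. The $\mathbb{Z}[\mathbf{C}]$-module $\langle\mathcal{F}_J^{(s)}\rangle$ is generated by a unique set of the form $\widetilde{\mathcal{F}}_J^{(s)}=\{\widetilde f_\gamma=x^\gamma-\sum_{x^\delta\in\mathcal{N}(J)_s}D_{\gamma\delta}x^\delta\mid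 x^\gamma\in J_s\text{ a monomial}\}$ with $D_{\gamma\delta}\in\mathbb{Z}[\mathbf{C}]$. Coefficients $E$: $x^\alpha,x^{\alpha'}\in\mathcal{B}_J$ are involved in a syzygy of Eliahou-Kervaire type if there are a variable $x_j>\min x^\alpha$ and a monomial $x^\nu$ with $x_jx^\alpha=x^{\alpha'}\ast_J x^\nu$; then $S^{\mathrm{EK}}(f_\alpha,f_{\alpha'}):=x_jf_\alpha-x^\nu f_{\alpha'}$, homogeneous of some degree $s$, and $E_{\alpha\alpha'\gamma},E_{\alpha\alpha'\delta}\in\mathbb{Z}[\mathbf{C}]$ are its coefficients: $S^{\mathrm{EK}}(f_\alpha,f_{\alpha'})=\sum_{x^\gamma\in J_s}E_{\alpha\alpha'\gamma}x^\gamma+\sum_{x^\delta\in\mathcal{N}(J)_s}E_{\alpha\alpha'\delta}x^\delta$ (sums over monomials). *)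

(* Defs.v *)
From HB Require Import structures.
From mathcomp Require Import all_boot all_order all_algebra.
From mathcomp.multinomials Require monalg.
From mathcomp.multinomials Require Import mpoly.

Set Implicit Arguments.
Unset Strict Implicit.
Unset Printing Implicit Defensive.

Import GRing.Theory.
Local Open Scope ring_scope.

(* Integer polynomials in an arbitrary (possibly infinite) family of variables:
   the monoid algebra over int of the free commutative monoid on I. Imported
   only here because monalg and mpoly define clashing notations. *)
Section IntegerPolynomials.
Import monalg.
Variable I : choiceType.

Definition int_poly : comNzRingType := {malg int[{cmonom I}]}.

Definition int_poly_var (i : I) : int_poly := << ucm i >>.

End IntegerPolynomials.

(* Monomials x^a are represented by their exponents a : 'X_{1..n.+1}; x_i is
   'X_i with i : 'I_n.+1, so that x_i < x_j is i < j. *)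

Definition lin_span (R : comNzRingType) (V : lmodType R) (S : V -> Prop)
    (v : V) : Prop :=
  exists (k : nat) (c : 'I_k -> R) (g : 'I_k -> V),
    (forall i, S (g i)) /\ v = \sum_(i < k) c i *: g i.

Definition ideal_gen (R : comNzRingType) (S : R -> Prop) (x : R) : Prop :=
  exists (k : nat) (c g : 'I_k -> R),
    (forall i, S (g i)) /\ x = \sum_(i < k) c i * g i.

Section Monomials.
Variable n : nat.
Implicit Types a d : 'X_{1..n.+1}.

Definition min_var a : option 'I_n.+1 :=
  [pick i : 'I_n.+1 | (0 < a i)%N & [forall j : 'I_n.+1, (0 < a j)%N ==> (i <= j)%N]].

Definition max_var a : option 'I_n.+1 :=
  [pick i : 'I_n.+1 | (0 < a i)%N & [forall j : 'I_n.+1, (0 < a j)%N ==> (j <= i)%N]].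

Definition min_ge_max a d : bool :=
  match min_var a, max_var d with
  | Some i, Some j => (j <= i)%N
  | _, _ => true
  end.

(* No variable is greater than min 1; this can only matter for J = (1), where
   the corresponding syzygies x_j f_1 - x_j f_1 vanish. *)
Definition gt_min (j : 'I_n.+1) a : bool :=
  if min_var a is Some i then (i < j)%N else false.

Implicit Type J : {pred {mpoly int[n.+1]}}.
Implicit Types M B : {pred 'X_{1..n.+1}}.

Definition generated_by_monomials J M : Prop :=
  forall p, p \in J <-> ideal_gen (fun q => exists2 a, a \in M & q = 'X_[a]) p.

Definition monomial_ideal J : Prop := exists M, generated_by_monomials J M.

Definition strongly_stable J : Prop :=
  monomial_ideal J /\
  forall (a : 'X_{1..n.+1}) (i j : 'I_n.+1),
    'X_[a] \in J -> (0 < a j)%N -> (j < i)%N -> 'X_[a - U_(j) + U_(i)] \in J.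

Definition minimal_monomial_generators J B : Prop :=
  generated_by_monomials J B /\
  forall M, {subset M <= B} -> generated_by_monomials J M -> {subset B <= M}.

End Monomials.

Section Coefficients.
Variables (n : nat) (J : {pred {mpoly int[n.+1]}}) (B : {pred 'X_{1..n.+1}}).

(* N(J)_s *)
Definition std_mon (s : nat) (b : 'X_{1..n.+1}) : bool :=
  (mdeg b == s) && ('X_[b] \notin J).

(* monomials of J_s *)
Definition ideal_mon (s : nat) (a : 'X_{1..n.+1}) : bool :=
  (mdeg a == s) && ('X_[a] \in J).

Definition Cindex : choiceType :=
  {ab : 'X_{1..n.+1} * 'X_{1..n.+1} |
    (ab.1 \in B) && std_mon (mdeg ab.1) ab.2}.
(* Z[C] *)
Definition ZC : comNzRingType := int_poly Cindex.

(* C_{ab}; the value 0 is only taken outside the index set of C. *)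
Definition Cvar (a b : 'X_{1..n.+1}) : ZC :=
  if insub (a, b) is Some ab then int_poly_var (ab : Cindex) else 0.

Definition marked_poly (a : 'X_{1..n.+1}) : {mpoly ZC[n.+1]} :=
  'X_[a] - \sum_(b : 'X_{1..n.+1 < (mdeg a).+1} | std_mon (mdeg a) b)
             Cvar a b *: 'X_[b].

(* the ideal generated by the marked set F_J *)
Definition idealI : {mpoly ZC[n.+1]} -> Prop :=
  ideal_gen (fun p => exists2 a, a \in B & p = marked_poly a).

(* N(J, I) *)
Definition NJI (p : {mpoly ZC[n.+1]}) : Prop :=
  idealI p /\ lin_span (fun q => exists2 b, 'X_[b] \notin J & q = 'X_[b]) p.

Definition x_coefficients (S : {mpoly ZC[n.+1]} -> Prop) (c : ZC) : Prop :=
  exists (p : {mpoly ZC[n.+1]}) (m : 'X_{1..n.+1}), S p /\ c = p@_m.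

(* F_J^(s); marked_poly a is homogeneous of degree mdeg a and contains 'X_[a]
   with coefficient 1. *)
Definition prolongations (s : nat) (p : {mpoly ZC[n.+1]}) : Prop :=
  exists a d : 'X_{1..n.+1},
    [/\ a \in B, min_ge_max a d, mdeg (d + a) = s & p = 'X_[d] * marked_poly a].

Section Reduced.
Variable D : 'X_{1..n.+1} -> 'X_{1..n.+1} -> ZC.

Definition reduced_poly (g : 'X_{1..n.+1}) : {mpoly ZC[n.+1]} :=
  'X_[g] - \sum_(d : 'X_{1..n.+1 < (mdeg g).+1} | std_mon (mdeg g) d)
             D g d *: 'X_[d].

Definition reduced_set (s : nat) (p : {mpoly ZC[n.+1]}) : Prop :=
  exists2 g, ideal_mon s g & p = reduced_poly g.

(* D is the family of coefficients D_{gd}: these are determined for g in J and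
   d outside J of the same degree, the other values being irrelevant. *)
Definition reduction_coefficients : Prop :=
  forall s p, lin_span (prolongations s) p <-> lin_span (reduced_set s) p.

End Reduced.

(* x_j x^a = x^a' *_J x^v with x_j > min x^a. The pair (j, v) is determined by
   (a, a'). *)
Definition EK_pair (a a' : 'X_{1..n.+1}) (j : 'I_n.+1) (v : 'X_{1..n.+1}) : Prop :=
  [/\ a \in B, a' \in B, gt_min j a, (U_(j) + a = a' + v)%MM
    & min_ge_max a' v].

Definition SEK (a a' : 'X_{1..n.+1}) (j : 'I_n.+1) (v : 'X_{1..n.+1}) :
    {mpoly ZC[n.+1]} :=
  'X_j * marked_poly a - 'X_[v] * marked_poly a'.

(* E_{a a' g} is (SEK a a' j v)@_g. *)
Definition Ppoly (D : 'X_{1..n.+1} -> 'X_{1..n.+1} -> ZC) (s : nat)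
    (a a' : 'X_{1..n.+1}) (j : 'I_n.+1) (v d : 'X_{1..n.+1}) : ZC :=
  (SEK a a' j v)@_d +
    \sum_(g : 'X_{1..n.+1 < s.+1} | ideal_mon s g) (SEK a a' j v)@_g * D g d.

(* SEK a a' j v is homogeneous of degree (mdeg a).+1 (possibly zero). *)
Definition EK_polys (D : 'X_{1..n.+1} -> 'X_{1..n.+1} -> ZC) (c : ZC) : Prop :=
  exists (a a' : 'X_{1..n.+1}) (j : 'I_n.+1) (v d : 'X_{1..n.+1}),
    [/\ EK_pair a a' j v, std_mon (mdeg a).+1 d
      & c = Ppoly D (mdeg a).+1 a a' j v d].

End Coefficients.

(* Main.v *)
Require Import Defs.
From mathcomp Require Import all_boot all_order all_algebra.
From mathcomp.multinomials Require Import mpoly.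

(* Let W be the set of polynomials whose reduction modulo the module spanned by
   the prolongations has its coefficients in the ideal of the P's. All of I
   lies in W, by induction on x^m in the products x^m f_a, for the lexicographic
   order: unless x^m f_a is a prolongation, some x_j > min x^a divides x^m, and
   x^m f_a = (x^m / x_j) (x^v f_a' + S^EK). The point is that modulo N(J), S^EK
   is a combination of prolongations x^d f_b with x^d < x_j, as x^d < x^e
   whenever x^e x^c = x^b *_J x^d with x^c outside J. *)

Set Implicit Arguments.
Unset Strict Implicit.
Unset Printing Implicit Defensive.

Import GRing.Theory.
Local Open Scope ring_scope.

(** * Linear spans *)

Section LinearSpan.
Variables (R : comNzRingType) (V : lmodType R).
Implicit Types (S T P : V -> Prop) (u v : V).

Lemma lin_span_gen S v : S v -> lin_span S v.
Proof.
move=> Sv; exists 1%N, (fun=> 1), (fun=> v); split=> //.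
by rewrite big_ord1 scale1r.
Qed.

Lemma lin_span0 S : lin_span S 0.
Proof.
exists 0%N, (fun=> 0), (fun=> 0); split; first by case.
by rewrite big_ord0.
Qed.

Lemma lin_spanD S u v : lin_span S u -> lin_span S v -> lin_span S (u + v).
Proof.
move=> [k [c [g [Sg ->]]]] [l [c' [g' [Sg' ->]]]].
exists (k + l)%N.
exists (fun i => match split i with inl i1 => c i1 | inr i2 => c' i2 end).
exists (fun i => match split i with inl i1 => g i1 | inr i2 => g' i2 end).
split=> [i|]; first by case: (split i).
rewrite big_split_ord /=; congr (_ + _); apply: eq_bigr => i _.
  by rewrite (unsplitK (inl i)).
by rewrite (unsplitK (inr i)).
Qed.

Lemma lin_spanZ S a v : lin_span S v -> lin_span S (a *: v).
Proof.
move=> [k [c [g [Sg ->]]]]; exists k, (fun i => a * c i), g; split=> //.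
by rewrite scaler_sumr; apply: eq_bigr => i _; rewrite scalerA.
Qed.

Lemma lin_span_min S P v :
  P 0 -> (forall a u w, P u -> P w -> P (a *: u + w)) ->
  (forall u, S u -> P u) -> lin_span S v -> P v.
Proof.
move=> P0 PD SP [k [c [g [Sg ->]]]].
elim/big_ind: _ => // [x y Px Py|i _]; first by rewrite -[x]scale1r; apply: PD.
by rewrite -[_ *: _]addr0; apply/PD/P0/SP.
Qed.

Lemma lin_span_sub S T v :
  (forall u, S u -> lin_span T u) -> lin_span S v -> lin_span T v.
Proof.
move=> ST; apply: (lin_span_min (P := lin_span T)) => //.
  exact: lin_span0.
by move=> a u w Tu Tw; apply/lin_spanD/Tw/lin_spanZ.
Qed.

Lemma lin_spanN S v : lin_span S v -> lin_span S (- v).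
Proof. by move=> Sv; rewrite -scaleN1r; apply: lin_spanZ. Qed.

Lemma lin_span_sum S (I : Type) (r : seq I) (Q : pred I) (F : I -> V) :
  (forall i, Q i -> lin_span S (F i)) -> lin_span S (\sum_(i <- r | Q i) F i).
Proof.
move=> SF; apply: (big_ind (lin_span S)) => //; first exact: lin_span0.
by move=> u v; apply: lin_spanD.
Qed.

Lemma lin_spanU S T v :
  lin_span (fun u => S u \/ T u) v ->
  exists u w, [/\ lin_span S u, lin_span T w & v = u + w].
Proof.
pose P v := exists u w, [/\ lin_span S u, lin_span T w & v = u + w].
apply: (lin_span_min (P := P)) => [|a x y Px Py|u].
- by exists 0, 0; split; [apply: lin_span0 | apply: lin_span0 | rewrite addr0].
- have [[u [w [Su Tw ->]]] [u' [w' [Su' Tw' ->]]]] := (Px, Py).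
  exists (a *: u + u'), (a *: w + w').
  split; [by apply/lin_spanD/Su'/lin_spanZ | by apply/lin_spanD/Tw'/lin_spanZ|].
  by rewrite scalerDr addrACA.
case=> Xu; [exists u, 0 | exists 0, u].
  by split; [apply: lin_span_gen | apply: lin_span0 | rewrite addr0].
by split; [apply: lin_span0 | apply: lin_span_gen | rewrite add0r].
Qed.

End LinearSpan.

(** * Generated ideals *)

Section IdealGen.
Variable R : comNzRingType.
Implicit Types (S T : R -> Prop) (x y : R).

(** An ideal is a span in the ring viewed as a module [R^o] over itself, where scaling is
    multiplication; this lemma and the following ones are thus instances of those on spans. *)
Lemma ideal_gen_gen S x : S x -> ideal_gen S x.
Proof. exact: (@lin_span_gen R R^o). Qed.

Lemma ideal_gen0 S : ideal_gen S 0.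
Proof. exact: (@lin_span0 R R^o). Qed.

Lemma ideal_genD S x y : ideal_gen S x -> ideal_gen S y -> ideal_gen S (x + y).
Proof. exact: (@lin_spanD R R^o). Qed.

Lemma ideal_genM S x y : ideal_gen S y -> ideal_gen S (x * y).
Proof. exact: (@lin_spanZ R R^o). Qed.

Lemma ideal_gen_sum S (I : Type) (r : seq I) (Q : pred I) (F : I -> R) :
  (forall i, Q i -> ideal_gen S (F i)) ->
  ideal_gen S (\sum_(i <- r | Q i) F i).
Proof. exact: (@lin_span_sum R R^o). Qed.

Lemma ideal_gen_sub S T x :
  (forall y, S y -> ideal_gen T y) -> ideal_gen S x -> ideal_gen T x.
Proof. exact: (@lin_span_sub R R^o). Qed.

End IdealGen.

(** * Smallest and greatest variables of a monomial *)

Section Monomials.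
Variable n : nat.
Implicit Types a b d e m : 'X_{1..n.+1}.

Lemma min_varP a :
  match min_var a with
  | Some i => (0 < a i)%N /\ forall j, (0 < a j)%N -> (i <= j)%N
  | None => forall j, a j = 0%N
  end.
Proof.
rewrite /min_var; case: pickP => [i /andP[ai /forallP le_i]|no_min].
  by split=> // j aj; apply: (implyP (le_i j)).
move=> j; apply/eqP; rewrite -leqn0 leqNgt; apply/negP => aj.
pose i := [arg min_(i < j | (0 < a i)%N) (i : nat)].
suff [ai le_i]: (0 < a i)%N /\ forall k, (0 < a k)%N -> (i <= k)%N.
  move: (no_min i); rewrite ai => /negP; case.
  by apply/forallP => k; apply/implyP => /le_i.
by rewrite /i; case: arg_minnP.
Qed.

Lemma max_varP a :
  match max_var a with
  | Some i => (0 < a i)%N /\ forall j, (0 < a j)%N -> (j <= i)%N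
  | None => forall j, a j = 0%N
  end.
Proof.
rewrite /max_var; case: pickP => [i /andP[ai /forallP le_i]|no_max].
  by split=> // j aj; apply: (implyP (le_i j)).
move=> j; apply/eqP; rewrite -leqn0 leqNgt; apply/negP => aj.
pose i := [arg max_(i > j | (0 < a i)%N) (i : nat)].
suff [ai le_i]: (0 < a i)%N /\ forall k, (0 < a k)%N -> (k <= i)%N.
  move: (no_max i); rewrite ai => /negP; case.
  by apply/forallP => k; apply/implyP => /le_i.
by rewrite /i; case: arg_maxnP.
Qed.

(** In this pairwise form the convention for the monomial 1 holds vacuously. *)
Lemma min_ge_maxP a d :
  reflect (forall i j, (0 < a i)%N -> (0 < d j)%N -> (j <= i)%N)
          (min_ge_max a d).
Proof.
rewrite /min_ge_max; have := min_varP a; have := max_varP d.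
case: (min_var a) => [i|]; case: (max_var d) => [j|].
- move=> [dj le_j] [ai le_i].
  apply: (iffP idP) => [le_ji k l ak dl|]; last exact.
  exact: leq_trans (le_j _ dl) (leq_trans le_ji (le_i _ ak)).
- by move=> d0 _; apply: ReflectT => k l _; rewrite d0.
- by move=> _ a0; apply: ReflectT => k l; rewrite a0.
- by move=> _ a0; apply: ReflectT => k l; rewrite a0.
Qed.

Lemma gt_minP (j : 'I_n.+1) a :
  reflect (exists2 i : 'I_n.+1, (0 < a i)%N & (i < j)%N) (gt_min j a).
Proof.
rewrite /gt_min; have := min_varP a; case: (min_var a) => [i [ai le_i]|a0].
  apply: (iffP idP) => [ltij|[k ak ltkj]]; first by exists i.
  exact: leq_ltn_trans (le_i _ ak) ltkj.
by apply: ReflectF => -[k]; rewrite a0.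
Qed.

Lemma min_ge_maxPn a d :
  ~~ min_ge_max a d -> exists2 j : 'I_n.+1, (0 < d j)%N & gt_min j a.
Proof.
move=> nle; have [j /andP[dj gt_j]|no_j] :=
  pickP (fun j : 'I_n.+1 => (0 < d j)%N && gt_min j a); first by exists j.
case/negP: nle; apply/min_ge_maxP => i j ai dj.
rewrite leqNgt; apply/negP => lt_ij.
by have := no_j j; rewrite dj => /negP; apply; apply/gt_minP; exists i.
Qed.

End Monomials.

(** * The lexicographic order and its well-foundedness *)

Section LexicographicOrder.
Variable n : nat.
Implicit Types a b d e m : 'X_{1..n}.

(** The greatest variable counts first and degrees are not compared: $k$ is the greatest index at
    which the exponents differ. *)
Definition lexm_lt d e :=
  exists2 k : 'I_n, (d k < e k)%N & forall l : 'I_n, (k < l)%N -> d l = e l.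

Lemma lexm_lt_trans d e m : lexm_lt d e -> lexm_lt e m -> lexm_lt d m.
Proof.
move=> [k dk de] [l el em]; case: (ltngtP k l) => [kl|lk|/val_inj kl].
- exists l => [|i li]; first by rewrite de.
  by rewrite de ?em // (ltn_trans kl).
- exists k => [|i ki]; first by rewrite -em.
  by rewrite de ?em // (ltn_trans lk).
- by subst l; exists k => [|i ki]; [apply: ltn_trans el | rewrite de ?em].
Qed.

Lemma lexm_ltD m d e : lexm_lt d e -> lexm_lt (m + d)%MM (m + e)%MM.
Proof.
move=> [k dk de]; exists k => [|l kl]; first by rewrite !mnmDE ltn_add2l.
by rewrite !mnmDE de.
Qed.

Lemma lexm_lt_total d e : [\/ lexm_lt d e, d = e | lexm_lt e d].
Proof.
case: (pickP (fun i => d i != e i)) => [i ne_i|eq_de]; last first.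
  by constructor 2; apply/mnmP => i; apply/eqP; rewrite -[_ == _]negbK eq_de.
pose k := [arg max_(k > i | d k != e k) (k : nat)].
have [ne_k eq_k] : d k != e k /\ forall l : 'I_n, (k < l)%N -> d l = e l.
  rewrite /k; case: arg_maxnP => // l ne_l le_l; split=> // l' lt_ll'.
  by apply/eqP/negPn/negP => /le_l; apply/negP; rewrite -ltnNge.
case: (ltngtP (d k) (e k)) => [lt_de|lt_ed|eq_de].
- by constructor 1; exists k.
- by constructor 3; exists k => // l /eq_k.
- by rewrite eq_de eqxx in ne_k.
Qed.

(** The same order on the first [N] entries of a sequence, in a form that allows recursion on the
    number of variables. *)
Fixpoint lex_lt N (d e : nat -> nat) :=
  if N is N'.+1 then (d N' < e N')%N \/ (d N' = e N' /\ lex_lt N' d e)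
  else False.

(** Three nested inductions: on [N], on a strict bound [x] for the leading entry, and, for a fixed
    bound, on the remaining entries by the well-foundedness already known for [N]. *)
Lemma lex_lt_wf N : well_founded (lex_lt N).
Proof.
elim: N => [|N IHN]; first by move=> d; constructor=> e [].
suff acc_bound x (d : nat -> nat) : (d N < x)%N -> Acc (lex_lt N.+1) d.
  by move=> d; apply: (acc_bound (d N).+1).
elim: x d => [|x IHx]; first by move=> d; rewrite ltn0.
apply: (well_founded_ind IHN) => d IHd.
rewrite ltnS => le_d; constructor=> e /= [lt_ed|[eq_ed lt_ed]].
  exact/IHx/(leq_trans lt_ed).
apply: IHd lt_ed _; rewrite eq_ed; exact: le_d.
Qed.

Lemma lexm_lt_wf : well_founded lexm_lt.
Proof.
pose F d (i : nat) := if insub i is Some j then d (j : 'I_n) else 0%N.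
have Fle d e : lexm_lt d e -> lex_lt n (F d) (F e).
  move=> [k dk de].
  (* The entry [k] decides the comparison at [N = k.+1]; each further entry up to [n] is an
     equality. *)
  suff: forall N, (N <= n)%N -> (k < N)%N -> lex_lt N (F d) (F e) by exact.
  elim=> // N IHN ltNn; rewrite ltnS leq_eqVlt => /predU1P[kN|ltkN] /=.
    by left; rewrite /F -kN valK.
  right; split; last exact: IHN (ltnW ltNn) ltkN.
  by rewrite /F insubT; apply: de.
suff acc_F x d : x = F d -> Acc lexm_lt d.
  by move=> d; apply: acc_F erefl.
move: x d; apply: (well_founded_ind (lex_lt_wf n)) => x IHx d xE.
constructor=> e /Fle; rewrite -xE => lt_ex; exact: IHx lt_ex _ erefl.
Qed.

End LexicographicOrder.

(** * Coefficients of monomial multiples and of bounded sums *)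

Lemma mcoeffXM n (R : comNzRingType) (p : {mpoly R[n]}) (m k : 'X_{1..n}) :
  ('X_[m] * p)@_k = if (m <= k)%MM then p@_(k - m) else 0.
Proof.
rewrite mulrC; case: ifPn => [le_mk|nle_mk].
  by rewrite -{1}(submK le_mk) addmC mcoeffMX.
apply/eqP; rewrite mcoeff_eq0 (perm_mem (msuppMX p m)).
by apply: contra nle_mk => /mapP[k' _ ->]; apply: lem_addr.
Qed.

(** Since [P] forces degree [s], the bound [s.+1] on the index type excludes no monomial satisfying
    [P]. *)
Lemma mcoeff_bounded_sum n (R : comNzRingType) (E : 'X_{1..n} -> R) s
    (P : pred 'X_{1..n}) m : (forall b, P b -> mdeg b = s) ->
  (\sum_(b : 'X_{1..n < s.+1} | P b) E b *: 'X_[b] : {mpoly R[n]})@_m =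
    if P m then E m else 0.
Proof.
move=> degP; rewrite raddf_sum /=; case: ifPn => Pm.
  have lt_ms : (mdeg m < s.+1)%N by rewrite (degP m Pm).
  rewrite (bigD1 (BMultinom lt_ms)) //= mcoeffZ mcoeffX eqxx mulr1.
  rewrite big1 ?addr0 // => b /andP[_ ne_bm]; rewrite mcoeffZ mcoeffX.
  by case: eqP => [Ebm|]; [case/eqP: ne_bm; apply: val_inj | rewrite mulr0].
rewrite big1 // => b Pb; rewrite mcoeffZ mcoeffX.
by case: eqP => [Ebm|]; [rewrite -Ebm Pb in Pm | rewrite mulr0].
Qed.

(** * Minimal generators and star decompositions in a strongly stable ideal *)

Section MonomialIdeal.
Variables (n : nat) (J : {pred {mpoly int[n.+1]}}) (B : {pred 'X_{1..n.+1}}).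
Hypothesis hJ : strongly_stable J.
Hypothesis hB : minimal_monomial_generators J B.
Implicit Types a b d e m g : 'X_{1..n.+1}.

Lemma generator_mem b : b \in B -> 'X_[b] \in J.
Proof.
move=> Bb; have [gen_J _] := hB; apply/gen_J.
by apply: ideal_gen_gen; exists b.
Qed.

Lemma mon_mem_le a b : (a <= b)%MM -> 'X_[a] \in J -> 'X_[b] \in J.
Proof.
have [gen_J _] := hB => le_ab /gen_J Ja; apply/gen_J.
by rewrite -(submK le_ab) mpolyXD; apply: ideal_genM.
Qed.

(** In an expression of $x^a$ by generators, some summand has a nonzero coefficient at $x^a$, so its
    generator divides $x^a$. *)
Lemma generator_le a : 'X_[a] \in J -> exists2 b, b \in B & (b <= a)%MM.
Proof.
have [gen_J _] := hB => /gen_J [k [c [g [Bg Xa]]]].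
have [i nz_i|all0] := pickP (fun i => (c i * g i)@_a != 0).
  have [b Bb gi] := Bg i; exists b => //.
  by move: nz_i; rewrite gi mulrC mcoeffXM; case: ifP; rewrite ?eqxx.
have /eqP := congr1 (mcoeff a) Xa.
rewrite mcoeffX eqxx raddf_sum big1 ?oner_eq0 // => i _.
by apply/eqP; rewrite -[_ == _]negbK all0.
Qed.

(** Otherwise $x^a$, a multiple of another generator $x^b$, could be removed from [B]. *)
Lemma generator_minimal a b : a \in B -> b \in B -> (b <= a)%MM -> b = a.
Proof.
have [gen_J min_B] := hB => Ba Bb le_ba; apply/eqP/negPn/negP => ne_ba.
pose M : {pred 'X_{1..n.+1}} := [pred m in B | m != a].
suff: a \in M by rewrite !inE eqxx andbF.
apply: (min_B M) => // [m /andP[] //|p].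
apply: (iff_trans (gen_J p)); split; apply: ideal_gen_sub => q [m Mm ->].
  have [->|ne_ma] := eqVneq m a; last first.
    by apply: ideal_gen_gen; exists m => //; rewrite !inE Mm.
  rewrite -(submK le_ba) mpolyXD; apply/ideal_genM/ideal_gen_gen.
  by exists b => //; rewrite !inE Bb.
by apply: ideal_gen_gen; exists m => //; case/andP: Mm.
Qed.

(* Divide g by its smallest variable for as long as the quotient stays in J:
   by strong stability, division of the last quotient by any other variable
   leaves J as well, so that it is a minimal generator. *)
Lemma star_decomposition g : 'X_[g] \in J ->
  exists b d, [/\ b \in B, min_ge_max b d & g = (b + d)%MM].
Proof.
have [s] := ubnP (mdeg g); elim: s g => // s IHs g; rewrite ltnS => le_gs Jg.
have [b Bb le_bg] := generator_le Jg.
have [eq_bg|ne_bg] := eqVneq b g.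
  exists b, 0%MM; split=> //; last by rewrite addm0.
  by apply/min_ge_maxP => i j _; rewrite mnm0E.
have [l lt_l] : exists l, (b l < g l)%N.
  apply/existsP; apply: contraNT ne_bg; rewrite negb_exists => /forallP le_gb.
  apply/eqP/mnmP => l; apply/eqP; rewrite eqn_leq (mnm_lepP le_bg) leqNgt.
  exact: le_gb.
have gl0 : (0 < g l)%N by apply: leq_ltn_trans lt_l.
have Jgl : 'X_[g - U_(l)] \in J.
  apply: mon_mem_le (generator_mem Bb); apply/mnm_lepP => k.
  rewrite mnmBE mnm1E; case: eqP => [<-|_]; last first.
    by rewrite subn0 (mnm_lepP le_bg).
  by rewrite subn1 -ltnS (ltn_predK gl0).
have := min_varP g; case: (min_var g) => [i [gi min_i]|g0]; last first.
  by move: gl0; rewrite g0.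
have le_U k : (0 < g k)%N -> (U_(k) <= g)%MM.
  by move=> gk; apply/mnm_lepP => k'; rewrite mnm1E; case: eqP => [<-|].
have Jgi : 'X_[g - U_(i)] \in J.
  have [<- //|ne_il] := eqVneq l i.
  have lt_il : (i < l)%N by rewrite ltn_neqAle min_i // eq_sym ne_il.
  (* $x^g/x_i$ arises from $x^g/x_l \in J$ by replacing $x_i$ with the greater variable $x_l$. *)
  suff -> : (g - U_(i) = (g - U_(l)) - U_(i) + U_(l))%MM.
    apply: hJ.2 lt_il => //.
    by rewrite mnmBE mnm1E (negPf ne_il) subn0.
  apply/mnmP => k; rewrite !(mnmDE, mnmBE, mnm1E).
  have [<-|ne_lk] := eqVneq l k; last by rewrite subn0 addn0.
  by rewrite eq_sym (negPf ne_il) !subn0 subn1 addn1 prednK.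
have lt_gi : (mdeg (g - U_(i)) < s)%N.
  apply: leq_trans le_gs; rewrite -{2}(submK (le_U i gi)) mdegD mdeg1.
  by rewrite addn1 ltnS.
have [b' [d [Bb' /min_ge_maxP le_bd Eg]]] := IHs _ lt_gi Jgi.
have Eg' : g = (b' + (d + U_(i)))%MM by rewrite addmA -Eg submK ?le_U.
(* The factor $x_i$ may join the second monomial: it is the smallest variable of $x^g$, hence at
   most any variable of $x^{b'}$. *)
exists b', (d + U_(i))%MM; split=> //; apply/min_ge_maxP => k j b'k.
rewrite mnmDE mnm1E; case: eqP => [<- _|_]; last by rewrite addn0; apply: le_bd.
by apply: min_i; rewrite Eg' mnmDE ltn_addr.
Qed.

(* If d were greater, the variables of b would all be at least the greatest one
   where d and e differ, and b would divide m. *)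
Lemma star_lexm_lt m e b d :
  (e + m = b + d)%MM -> min_ge_max b d -> ~ (b <= m)%MM -> lexm_lt d e.
Proof.
move=> Eg /min_ge_maxP le_bd nle_bm.
have Ek k : (e k + m k = b k + d k)%N by rewrite -!mnmDE Eg.
case: (lexm_lt_total d e) => // [Ede|[k lt_k eq_k]]; case: nle_bm.
  by apply/mnm_lepP => k; have := Ek k; rewrite Ede addnC => /addIn ->.
apply/mnm_lepP => l; case: (ltngtP k l) => [/eq_k El|lt_lk|/val_inj <-].
- by have := Ek l; rewrite El addnC => /addIn ->.
- rewrite leqNgt; apply/negP => lt_l.
  have bl := leq_ltn_trans (leq0n _) lt_l.
  have := le_bd l k bl (leq_ltn_trans (leq0n _) lt_k).
  by rewrite leqNgt lt_lk.
- rewrite -(leq_add2r (e k)) [(m k + _)%N]addnC Ek leq_add2l.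
  exact: ltnW.
Qed.

End MonomialIdeal.

(** * Marked polynomials, their syzygies and normal forms *)

(* The coefficients C_ab range over an arbitrary commutative ring R here; the
   definitions of Defs are recovered for R = ZC J B and C = Cvar J B. *)
Section MarkedSet.
Variables (n : nat) (J : {pred {mpoly int[n.+1]}}) (B : {pred 'X_{1..n.+1}}).
Variables (R : comNzRingType) (C D : 'X_{1..n.+1} -> 'X_{1..n.+1} -> R).
Implicit Types a b d e g m v : 'X_{1..n.+1}.
Implicit Types p q h : {mpoly R[n.+1]}.

(** One shape for both families: [E := C] gives $f_\alpha$ and [E := D] gives $\widetilde
    f_\gamma$. *)
Definition tail_poly (E : 'X_{1..n.+1} -> 'X_{1..n.+1} -> R) g :
    {mpoly R[n.+1]} :=
  'X_[g] - \sum_(d : 'X_{1..n.+1 < (mdeg g).+1} | std_mon J (mdeg g) d)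
             E g d *: 'X_[d].

Local Notation f := (tail_poly C).

Definition marked_ideal : {mpoly R[n.+1]} -> Prop :=
  ideal_gen (fun p => exists2 a, a \in B & p = f a).

Definition standard p := exists2 b, 'X_[b] \notin J & p = 'X_[b].

Definition marked_prolongations s p := exists a d,
  [/\ a \in B, min_ge_max a d, mdeg (d + a) = s & p = 'X_[d] * f a].

Definition EK_syzygy a a' (j : 'I_n.+1) v : {mpoly R[n.+1]} :=
  'X_j * f a - 'X_[v] * f a'.

Definition EK_coeff s a a' j v d : R :=
  (EK_syzygy a a' j v)@_d +
    \sum_(g : 'X_{1..n.+1 < s.+1} | ideal_mon J s g)
      (EK_syzygy a a' j v)@_g * D g d.

Definition EK_coeffs c := exists a a' j v d,
  [/\ EK_pair B a a' j v, std_mon J (mdeg a).+1 d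
    & c = EK_coeff (mdeg a).+1 a a' j v d].

Hypothesis hJ : strongly_stable J.
Hypothesis hB : minimal_monomial_generators J B.
Hypothesis hD : forall s p, lin_span (marked_prolongations s) p <->
  lin_span (fun q => exists2 g, ideal_mon J s g & q = tail_poly D g) p.

Lemma std_mon_deg s b : std_mon J s b -> mdeg b = s.
Proof. by case/andP=> /eqP. Qed.

Lemma ideal_mon_deg s b : ideal_mon J s b -> mdeg b = s.
Proof. by case/andP=> /eqP. Qed.

Lemma mcoeff_tail_poly E g m :
  (tail_poly E g)@_m =
    (g == m)%:R - (if std_mon J (mdeg g) m then E g m else 0).
Proof.
rewrite /tail_poly mcoeffB mcoeffX; congr (_ - _).
exact: (mcoeff_bounded_sum (E g) m (@std_mon_deg (mdeg g))).
Qed.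

Lemma mcoeff_tail_poly_deg a m : mdeg m != mdeg a -> (f a)@_m = 0.
Proof.
move=> ne_deg; rewrite mcoeff_tail_poly /std_mon (negPf ne_deg).
by case: eqP => [Eam|_]; [rewrite Eam eqxx in ne_deg | rewrite subrr].
Qed.

(** Both products are homogeneous of degree $|a|+1$, because $x_j x^a = x^{a'} x^v$. *)
Lemma mcoeff_EK_syzygy_deg a a' j v m :
  EK_pair B a a' j v -> mdeg m != (mdeg a).+1 -> (EK_syzygy a a' j v)@_m = 0.
Proof.
have shift d b : mdeg m != mdeg (d + b) -> ('X_[d] * f b)@_m = 0.
  rewrite mcoeffXM; case: ifP => // le_dm ne_deg.
  apply: mcoeff_tail_poly_deg; apply: contraNneq ne_deg => eq_deg.
  by rewrite mdegD -eq_deg -mdegD addmC submK.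
move=> [_ _ _ Ev _] ne_deg; have deg_ja : mdeg (U_(j) + a) = (mdeg a).+1.
  by rewrite mdegD mdeg1.
have Xja0 : ('X_[U_(j)] * f a)@_m = 0 by apply: shift; rewrite deg_ja.
have Xva0 : ('X_[v] * f a')@_m = 0 by apply: shift; rewrite addmC -Ev deg_ja.
by rewrite /EK_syzygy mcoeffB Xja0 Xva0 subrr.
Qed.

(* The coefficient of x^d in the reduction of p by the polynomials tail_poly. *)
Definition nf_coeff d p : R :=
  p@_d + \sum_(g : 'X_{1..n.+1 < (mdeg d).+1} | ideal_mon J (mdeg d) g)
           p@_g * D g d.

Lemma nf_coeff0 d : nf_coeff d 0 = 0.
Proof.
by rewrite /nf_coeff mcoeff0 add0r big1 // => g _; rewrite mcoeff0 mul0r.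
Qed.

Lemma nf_coeff_linear d c p q :
  nf_coeff d (c *: p + q) = c * nf_coeff d p + nf_coeff d q.
Proof.
rewrite /nf_coeff mulrDr addrACA mulr_sumr -big_split /= mcoeffD mcoeffZ.
congr (_ + _); apply: eq_bigr => g _.
by rewrite mcoeffD mcoeffZ mulrDl mulrA.
Qed.

(** The only monomial of $J$ in $\widetilde f_g$ is $x^g$; in degree $|g|$ its contribution $D_{gd}$
    cancels the coefficient $-D_{gd}$ of $x^d$, and in other degrees every term is zero. *)
Lemma nf_coeff_tail_poly d g : 'X_[d] \notin J -> 'X_[g] \in J ->
  nf_coeff d (tail_poly D g) = 0.
Proof.
move=> nJd Jg; have ne_gd : g != d by apply: contraNneq nJd => <-.
have mcoeff_J c : 'X_[c] \in J -> (tail_poly D g)@_c = (g == c)%:R.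
  by move=> Jc; rewrite mcoeff_tail_poly /std_mon Jc andbF subr0.
rewrite /nf_coeff mcoeff_tail_poly (negPf ne_gd) sub0r /std_mon nJd andbT.
have [deg_d|ne_deg] := eqVneq (mdeg d) (mdeg g); last first.
  rewrite oppr0 add0r big1 // => c /andP[/eqP deg_c Jc]; rewrite mcoeff_J //.
  by case: eqP => [Egc|]; [rewrite Egc deg_c eqxx in ne_deg | rewrite mul0r].
have lt_g : (mdeg g < (mdeg d).+1)%N by rewrite deg_d.
rewrite (bigD1 (BMultinom lt_g)) /=; last by rewrite /ideal_mon deg_d eqxx.
rewrite mcoeff_J // eqxx mul1r addKr big1 // => c.
case/andP=> /andP[_ Jc] ne_cg; rewrite mcoeff_J //.
by case: eqP => [Egc|]; [case/eqP: ne_cg; apply: val_inj | rewrite mul0r].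
Qed.

(** By [hD], prolongations are combinations of the $\widetilde f_g$, on which the linear form
    [nf_coeff d] vanishes. *)
Lemma nf_coeff_prolongation d s p : 'X_[d] \notin J ->
  lin_span (marked_prolongations s) p -> nf_coeff d p = 0.
Proof.
move=> nJd /hD; apply: (lin_span_min (P := fun q => nf_coeff d q = 0)).
- exact: nf_coeff0.
- by move=> c q q' q0 q'0; rewrite nf_coeff_linear q0 q'0 mulr0 addr0.
by move=> q [g /andP[_ Jg] ->]; apply: nf_coeff_tail_poly.
Qed.

Lemma standard_mcoeff h m : lin_span standard h -> 'X_[m] \in J -> h@_m = 0.
Proof.
move=> std_h Jm; move: std_h; apply: (lin_span_min (P := fun q => q@_m = 0)).
- by rewrite mcoeff0.
- by move=> c q q' q0 q'0; rewrite mcoeffD mcoeffZ q0 q'0 mulr0 addr0.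
move=> q [b nJb ->]; rewrite mcoeffX; case: eqP => // Ebm.
by rewrite Ebm Jm in nJb.
Qed.

Lemma nf_coeff_standard h d : lin_span standard h -> nf_coeff d h = h@_d.
Proof.
move=> std_h; rewrite /nf_coeff big1 ?addr0 // => g /andP[_ Jg].
by rewrite standard_mcoeff ?mul0r.
Qed.

Lemma standard_span h :
  (forall m, 'X_[m] \in J -> h@_m = 0) -> lin_span standard h.
Proof.
move=> h0; rewrite [h]mpolyE big_seq; apply: lin_span_sum => m.
rewrite mcoeff_msupp => nz_m; apply/lin_spanZ/lin_span_gen; exists m => //.
by apply: contraNN nz_m => /h0 ->.
Qed.

(** * Syzygies as combinations of prolongations with smaller multipliers *)

Definition prolongation_below e p :=
  exists b d, [/\ b \in B, min_ge_max b d, lexm_lt d e & p = 'X_[d] * f b].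

(* Rewriting a monomial of J in the product x^e x^m by its star decomposition
   x^b x^d only produces multiples of x^d, with d < e by star_lexm_lt. *)
Lemma std_multiple_span e m : 'X_[m] \notin J ->
  lin_span (fun p => prolongation_below e p \/ standard p) 'X_[e + m].
Proof.
move: m; elim/(well_founded_ind (@lexm_lt_wf n.+1)): e => e IHe m nJm.
have [Jem|nJem] := boolP ('X_[e + m] \in J); last first.
  by apply: lin_span_gen; right; exists (e + m)%MM.
have [b [d [Bb le_bd Eem]]] := star_decomposition hJ hB Jem.
have lt_de : lexm_lt d e.
  apply: star_lexm_lt Eem le_bd _ => le_bm; case/negP: nJm.
  exact: (mon_mem_le hB le_bm (generator_mem hB Bb)).
have -> : 'X_[e + m] = 'X_[d] * f b +
    \sum_(c : 'X_{1..n.+1 < (mdeg b).+1} | std_mon J (mdeg b) c)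
       C b c *: 'X_[d + c].
  rewrite /tail_poly mulrBr mulr_sumr -mpolyXD [(d + b)%MM]addmC -Eem -addrA.
  rewrite (eq_bigr (fun c : 'X_{1..n.+1 < (mdeg b).+1} =>
             C b c *: 'X_[d + c])) ?addNr ?addr0 // => c _.
  by rewrite -scalerAr mpolyXD.
apply: lin_spanD; first by apply: lin_span_gen; left; exists b, d.
apply: lin_span_sum => c /andP[_ nJc]; apply: lin_spanZ.
(* Each remaining monomial is $x^d x^c$ with $x^c \notin J$, so the induction hypothesis applies
   with [d] and [c] in place of [e] and [m]. *)
apply: lin_span_sub (IHe d lt_de c nJc) => p [].
  move=> [b' [d' [Bb' le_bd' lt_d' ->]]].
  apply: lin_span_gen; left; exists b', d'; split=> //.
  exact: lexm_lt_trans lt_de.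
by move=> std_p; apply: lin_span_gen; right.
Qed.

(** [star_lexm_lt] applies once $x^{a'}$ does not divide $x^a$. If it did, minimality would give $a'
    = a$ and $x^v = x_j$, against $x_j > \min x^a \ge \max x^v$. *)
Lemma EK_pair_lexm_lt a a' j v : EK_pair B a a' j v -> lexm_lt v U_(j).
Proof.
move=> [Ba Ba' /gt_minP [i ai lt_ij] Ev le_v].
apply: (star_lexm_lt Ev le_v) => le_a'a.
have Ea := generator_minimal hB Ba Ba' le_a'a; subst a'.
have Ej : v = U_(j)%MM by apply/(@addmI _ a); rewrite -Ev addmC.
have /min_ge_maxP /(_ i j ai) := le_v; rewrite Ej mnm1E eqxx => /(_ isT).
by rewrite leqNgt lt_ij.
Qed.

(** The leading monomials cancel. What is left are multiples by $x_j$ or $x^v$ of monomials outside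
    $J$, and $x^v < x_j$. *)
Lemma EK_syzygy_span a a' j v : EK_pair B a a' j v ->
  lin_span (fun p => prolongation_below U_(j) p \/ standard p)
           (EK_syzygy a a' j v).
Proof.
move=> EK; have [_ _ _ Ev _] := EK; have lt_vj := EK_pair_lexm_lt EK.
have -> : EK_syzygy a a' j v =
    - (\sum_(c : 'X_{1..n.+1 < (mdeg a).+1} | std_mon J (mdeg a) c)
         C a c *: 'X_[U_(j) + c]) +
    \sum_(c : 'X_{1..n.+1 < (mdeg a').+1} | std_mon J (mdeg a') c)
       C a' c *: 'X_[v + c].
  rewrite /EK_syzygy /tail_poly !mulrBr !mulr_sumr -!mpolyXD.
  rewrite Ev [(v + a')%MM]addmC opprB addrC addrA subrK addrC; congr (- _ + _);
    by apply: eq_bigr => c _; rewrite -scalerAr mpolyXD.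
apply: lin_spanD; first apply: lin_spanN;
  apply: lin_span_sum => c /andP[_ nJc]; apply: lin_spanZ.
  exact: std_multiple_span.
apply: lin_span_sub (std_multiple_span v nJc) => p [].
  move=> [b [d [Bb le_bd lt_d ->]]].
  apply: lin_span_gen; left; exists b, d; split=> //.
  exact: lexm_lt_trans lt_vj.
by move=> std_p; apply: lin_span_gen; right.
Qed.

Lemma nf_coeff_EK_syzygy d a a' j v : EK_pair B a a' j v -> 'X_[d] \notin J ->
  ideal_gen EK_coeffs (nf_coeff d (EK_syzygy a a' j v)).
Proof.
move=> EK nJd; have [deg_d|ne_deg] := eqVneq (mdeg d) (mdeg a).+1.
  apply: ideal_gen_gen; exists a, a', j, v, d; split=> //.
    by rewrite /std_mon deg_d eqxx.
  by rewrite /nf_coeff deg_d.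
rewrite /nf_coeff mcoeff_EK_syzygy_deg // add0r big1; first exact: ideal_gen0.
by move=> g /ideal_mon_deg Eg; rewrite mcoeff_EK_syzygy_deg ?mul0r // Eg.
Qed.

(** * Normal forms of the elements of the marked ideal *)

Definition nf_in_ideal p :=
  forall d, 'X_[d] \notin J -> ideal_gen EK_coeffs (nf_coeff d p).

Lemma nf_in_ideal_span (S : {mpoly R[n.+1]} -> Prop) p :
  (forall q, S q -> nf_in_ideal q) -> lin_span S p -> nf_in_ideal p.
Proof.
move=> SI; apply: (lin_span_min (P := nf_in_ideal)) => //.
  by move=> d _; rewrite nf_coeff0; apply: ideal_gen0.
move=> c q q' Iq Iq' d nJd; rewrite nf_coeff_linear.
by apply: ideal_genD (Iq' d nJd); apply/ideal_genM/Iq.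
Qed.

Lemma nf_in_ideal_coeffs p :
  (forall m, ideal_gen EK_coeffs p@_m) -> nf_in_ideal p.
Proof.
move=> Ip d _; apply: ideal_genD => //; apply: ideal_gen_sum => g _.
by rewrite mulrC; apply: ideal_genM.
Qed.

(** The induction on [m] treats all generators at once, since rewriting $x^m f_a$ brings in other
    $f_b$ with smaller multipliers. *)
Lemma nf_in_ideal_multiple m a : a \in B -> nf_in_ideal ('X_[m] * f a).
Proof.
move: a; elim/(well_founded_ind (@lexm_lt_wf n.+1)): m => m IHm a Ba.
have [le_am|/min_ge_maxPn [j mj gt_j]] := boolP (min_ge_max a m).
  move=> d nJd; rewrite (@nf_coeff_prolongation d (mdeg (m + a))) //.
    exact: ideal_gen0.
  by apply: lin_span_gen; exists a, m.
have Ja : 'X_[U_(j) + a] \in J.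
  exact: (mon_mem_le hB (lem_addl _ _) (generator_mem hB Ba)).
have [a' [v [Ba' le_v Ev]]] := star_decomposition hJ hB Ja.
have EK : EK_pair B a a' j v by [].
have [p [h [span_p std_h Eph]]] := lin_spanU (EK_syzygy_span EK).
(* The prolongations in [p] reduce to zero, so outside $J$ the coefficients of [h] are the normal
   form coefficients of the syzygy. *)
have Ih c : ideal_gen EK_coeffs h@_c.
  have [Jc|nJc] := boolP ('X_[c] \in J).
    by rewrite standard_mcoeff //; apply: ideal_gen0.
  suff -> : h@_c = nf_coeff c (EK_syzygy a a' j v) by apply: nf_coeff_EK_syzygy.
  rewrite -(nf_coeff_standard c std_h) Eph -[p]scale1r nf_coeff_linear mul1r.
  suff -> : nf_coeff c p = 0 by rewrite add0r.
  apply: (lin_span_min (P := fun q => nf_coeff c q = 0)) span_p.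
  - exact: nf_coeff0.
  - by move=> x q q' q0 q'0; rewrite nf_coeff_linear q0 q'0 mulr0 addr0.
  move=> q [b [d [Bb le_bd _ ->]]].
  apply: (@nf_coeff_prolongation c (mdeg (d + b))) => //.
  by apply: lin_span_gen; exists b, d.
set w := (m - U_(j))%MM.
have Em : m = (w + U_(j))%MM.
  by rewrite submK //; apply/mnm_lepP => k; rewrite mnm1E; case: eqP => [<-|].
(* With $x^m = x^w x_j$, this is $x^w$ times $x_j f_a = x^v f_{a'} + S^{EK}$, where $S^{EK} = p +
   h$. Multiplication by $x^w$ preserves the order, so the multipliers in the first two terms lie
   below $x^m$. *)
have -> : 'X_[m] * f a = 'X_[w + v] * f a' + ('X_[w] * p + 'X_[w] * h).
  rewrite -mulrDr -Eph {1}Em !mpolyXD -!mulrA -mulrDr; congr (_ * _).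
  by rewrite addrC subrK.
have lt_w e : lexm_lt e U_(j) -> lexm_lt (w + e) m.
  by move=> lt_e; rewrite Em; apply: lexm_ltD.
have nfD q q' : nf_in_ideal q -> nf_in_ideal q' -> nf_in_ideal (q + q').
  move=> Iq Iq' d nJd; rewrite -[q]scale1r nf_coeff_linear mul1r.
  by apply: ideal_genD; [apply: Iq | apply: Iq'].
apply: (nfD _ _ _ (nfD _ _ _ _)).
- by apply: IHm => //; apply/lt_w/(EK_pair_lexm_lt EK).
- apply: (lin_span_min (P := fun q => nf_in_ideal ('X_[w] * q))) span_p.
  + by rewrite mulr0 => d _; rewrite nf_coeff0; apply: ideal_gen0.
  + move=> c q q' Iq Iq' d nJd; rewrite mulrDr -scalerAr nf_coeff_linear.
    by apply: ideal_genD (Iq' d nJd); apply/ideal_genM/Iq.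
  move=> q [b [d [Bb _ lt_d ->]]]; rewrite mulrA -mpolyXD.
  by apply: IHm => //; apply: lt_w.
(* $x^w h$ may involve monomials of $J$, but all its coefficients lie in the ideal, which linearity
   of the reduction preserves. *)
- apply: nf_in_ideal_coeffs => c; rewrite mcoeffXM.
  by case: ifP => _; [apply: Ih | apply: ideal_gen0].
Qed.

(** [nf_in_ideal] is stable under linear combinations over [R], so the polynomial multipliers are
    first expanded into monomials. *)
Lemma marked_ideal_nf p : marked_ideal p -> nf_in_ideal p.
Proof.
move=> [k [c [g [Bg ->]]]].
have -> : \sum_(i < k) c i * g i =
    \sum_(i < k) \sum_(m <- msupp (c i)) (c i)@_m *: ('X_[m] * g i).
  apply: eq_bigr => i _; rewrite {1}[c i]mpolyE mulr_suml.
  by apply: eq_bigr => m _; rewrite scalerAl.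
apply: (@nf_in_ideal_span (fun q => exists a m, a \in B /\ q = 'X_[m] * f a)).
  by move=> q [a [m [Ba ->]]]; apply: nf_in_ideal_multiple.
apply: lin_span_sum => i _; apply: lin_span_sum => m _.
apply/lin_spanZ/lin_span_gen; have [a Ba ->] := Bg i.
by exists a, m.
Qed.

(** A polynomial supported outside $J$ is its own normal form. *)
Lemma std_ideal_coeff p m : marked_ideal p -> lin_span standard p ->
  ideal_gen EK_coeffs p@_m.
Proof.
move=> Ip std_p; have [Jm|nJm] := boolP ('X_[m] \in J).
  by rewrite (standard_mcoeff std_p Jm); apply: ideal_gen0.
by rewrite -(nf_coeff_standard m std_p); apply: marked_ideal_nf.
Qed.

(** * From syzygies to ideal elements supported outside $J$ *)

Lemma tail_poly_marked_ideal g : 'X_[g] \in J -> marked_ideal (tail_poly D g).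
Proof.
move=> Jg; have [] : lin_span (marked_prolongations (mdeg g)) (tail_poly D g).
  by apply/hD/lin_span_gen; exists g => //; rewrite /ideal_mon eqxx.
move=> k [c [q [Pq ->]]]; apply: ideal_gen_sum => i _.
have [a [d [Ba _ _ ->]]] := Pq i; rewrite scalerAl.
by apply/ideal_genM/ideal_gen_gen; exists a.
Qed.

(** The witness is the reduction $S - \sum_g S_g \widetilde f_g$ of the syzygy: subtraction removes
    the monomials of $J$ and adds $\sum_g S_g D_{gd}$ to the coefficient of $x^d$. *)
Lemma EK_coeff_std_ideal a a' j v d :
  EK_pair B a a' j v -> std_mon J (mdeg a).+1 d ->
  exists p m, [/\ marked_ideal p, lin_span standard p
    & EK_coeff (mdeg a).+1 a a' j v d = p@_m].
Proof.
move=> EK std_d; set s := (mdeg a).+1 in std_d *; set S := EK_syzygy a a' j v.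
pose h := S - \sum_(g : 'X_{1..n.+1 < s.+1} | ideal_mon J s g)
                S@_g *: tail_poly D g.
have hE m : h@_m = S@_m - (if ideal_mon J s m then S@_m else 0) +
    (if std_mon J s m then
       \sum_(g : 'X_{1..n.+1 < s.+1} | ideal_mon J s g) S@_g * D g m else 0).
  rewrite mcoeffB -addrA; congr (_ + _); rewrite [RHS]addrC -opprB; congr (- _).
  rewrite -(mcoeff_bounded_sum (fun g => S@_g) m (@ideal_mon_deg s)).
  have -> : (if std_mon J s m then
       \sum_(g : 'X_{1..n.+1 < s.+1} | ideal_mon J s g) S@_g * D g m else 0) =
    \sum_(g : 'X_{1..n.+1 < s.+1} | ideal_mon J s g)
       (if std_mon J s m then S@_g * D g m else 0).
    by case: ifP => // _; rewrite big1.
  rewrite !(raddf_sum (mcoeff m)) -sumrB; apply: eq_bigr => g Jg /=.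
  rewrite !mcoeffZ mcoeff_tail_poly mcoeffX (ideal_mon_deg Jg) mulrBr.
  by case: ifP; rewrite ?mulr0.
exists h, d; split.
- apply: ideal_genD.
    have [Ba Ba' _ _ _] := EK; rewrite /S /EK_syzygy -mulNr.
    apply: ideal_genD; apply/ideal_genM/ideal_gen_gen; first by exists a.
    by exists a'.
  rewrite -mulN1r; apply/ideal_genM/ideal_gen_sum => g /andP[_ Jg].
  rewrite -[tail_poly _ _]mul1r scalerAl.
  exact/ideal_genM/tail_poly_marked_ideal.
- apply: standard_span => m Jm.
  rewrite hE /std_mon /ideal_mon Jm andbF andbT addr0.
  (* In degree [s] the two coefficients cancel; in other degrees homogeneity of the syzygy is
     used. *)
  by case: eqP => [_|/eqP ne_deg]; rewrite ?subrr // subr0 mcoeff_EK_syzygy_deg.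
- have /andP[_ nJd] := std_d.
  by rewrite hE std_d /ideal_mon (negPf nJd) andbF subr0.
Qed.

End MarkedSet.

(** * Comparison of the two ideals of [ZC J B] *)

Theorem corollary2p13 (n : nat) (J : {pred {mpoly int[n.+1]}})
    (B : {pred 'X_{1..n.+1}})
    (D : 'X_{1..n.+1} -> 'X_{1..n.+1} -> ZC J B)
    (hJ : strongly_stable J)
    (hB : minimal_monomial_generators J B)
    (hD : reduction_coefficients D) :
  forall c : ZC J B,
    ideal_gen (x_coefficients (@NJI n J B)) c <-> ideal_gen (EK_polys D) c.
Proof.
(* Each inclusion is checked on generators; for [C := Cvar J B] the general notions unfold to those
   of the statement. *)
move=> c; split; apply: ideal_gen_sub => {}c.
  move=> [p [m [[Ip std_p] ->]]].
  exact: (@std_ideal_coeff n J B _ (Cvar J B) D hJ hB hD p m Ip std_p).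
move=> [a [a' [j [v [d [EK std_d ->]]]]]]; apply: ideal_gen_gen.
have [p [m [Ip std_p Ec]]] :=
  @EK_coeff_std_ideal n J B _ (Cvar J B) D hD a a' j v d EK std_d.
by exists p, m.
Qed.
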